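(* Let $0<q<1$. The sequences $$\left(q^{2n}\frac{\mathrm{Cos}_q\xi_n}{\mathrm{Sin}_q'\xi_n}\right)_{n=1}^{\infty}\qquad\text{and}\qquad\left(q^{2n}\frac{\mathrm{Sin}_q\eta_n}{\mathrm{Cos}_q'\eta_n}\right)_{n=1}^{\infty}$$ are bounded.
   Context: Fix $0<q<1$. $(x;q)_\infty=\prod_{j\ge 0}(1-xq^j)$, $E_q(z)=(-(1-q)z;q)_\infty$, $\mathrm{Sin}_q z=\frac{E_q(iz)-E_q(-iz)}{2i}$, $\mathrm{Cos}_q z=\frac{E_q(iz)+E_q(-iz)}{2}$. All zeros of $\mathrm{Sin}_q$ and $\mathrm{Cos}_q$ are real and simple; $(\xi_k)_{k\ge1}$ and $(\eta_k)_{k\ge1}$ denote their respective positive zeros in increasing order. Known asymptotics: $\xi_k\sim \frac{q^{-3/2}}{1-q}q^{-2k}$ and $\eta_k\sim\frac{q^{-1/2}}{1-q}q^{-2k}$ up to the choice of indexing constant, as $k\to\infty$; in particular $\xi_{k+1}/\xi_k\to q^{-2}$ and $\eta_{k+1}/\eta_k\to q^{-2}$. Primes denote ordinary derivatives. *)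

(* Defs.v *)
From HB Require Import structures.
From mathcomp Require Import all_boot all_order all_algebra.
From mathcomp Require Import complex.
From mathcomp Require Import all_classical all_reals all_analysis.
Set Implicit Arguments.
Unset Strict Implicit.
Unset Printing Implicit Defensive.
Import Order.TTheory GRing.Theory Num.Theory numFieldNormedType.Exports.

Local Open Scope classical_set_scope.
Local Open Scope ring_scope.
Local Open Scope complex_scope.

(* R[i] carries its norm topology only through the alias R[i]^o; the casts to
   R[i]^o below serve to take limits and derivatives and are the identity. *)

Definition qpoch_inf (R : realType) (x : R[i]) (q : R) : R[i] :=
  limn (fun n : nat => \prod_(j < n) (1 - x * q%:C ^+ j) : R[i]^o).

Definition E_q (R : realType) (q : R) (z : R[i]) : R[i] :=
  qpoch_inf (- (1 - q%:C) * z) q.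

Definition Sin_q (R : realType) (q : R) (z : R[i]) : R[i] :=
  (E_q q ('i%C * z) - E_q q (- 'i%C * z)) / (2%:R * 'i%C).

Definition Cos_q (R : realType) (q : R) (z : R[i]) : R[i] :=
  (E_q q ('i%C * z) + E_q q (- 'i%C * z)) / 2%:R.

Definition cderiv (R : realType) (f : R[i] -> R[i]) (z : R[i]) : R[i] :=
  derive1 (f : R[i]^o -> R[i]^o) z.

(* The sequence x_1 < x_2 < ... enumerates the zeros of f in (0, +oo). Indices
   start at 1: the value x 0 is irrelevant. *)
Definition positive_zeros (R : realType) (f : R[i] -> R[i]) (x : nat -> R)
  : Prop :=
  (forall m n : nat, (1 <= m)%N -> (m < n)%N -> x m < x n) /\
  (forall t : R,
     (0 < t /\ f t%:C = 0) <-> (exists2 n : nat, (1 <= n)%N & x n = t)).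

(* Main.v *)
(* Write E_q(iz) = (w; q)_oo with w = -i(1-q)z, so that for real z the values
   Cos_q z and Sin_q z are its real and imaginary parts. The logarithmic
   derivative L of w |-> (w; q)_oo satisfies
     - Re L = sum_j q^j / (1 + ((1-q) z)^2 q^(2j)),
   and at a zero of one of the two functions the quotient of the other one by
   the derivative is +-1 / ((1-q) Re L). Keeping the term j = 2(N+n), it suffices
   that the n-th zero is at most q^(-2(N+n)) / (1-q) for some fixed N. Now
     (-i q^(-2n); q)_oo = (-1)^n K (1 + i) (-i q^(2n+1); q)_oo   with K > 0,
   whose last factor tends to 1: for large n both functions have the sign
   (-1)^n at q^(-2n) / (1-q), and the intermediate value theorem provides
   enough zeros. *)

Require Import Defs.
From HB Require Import structures.
From mathcomp Require Import all_boot all_order all_algebra.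
From mathcomp Require Import complex.
From mathcomp Require Import all_classical all_reals all_analysis.
From mathcomp Require Import ring lra.
Import Order.TTheory GRing.Theory Num.Theory numFieldNormedType.Exports.
Local Open Scope classical_set_scope.
Local Open Scope ring_scope.
Local Open Scope complex_scope.
Import ComplexField.Normc.

Set Implicit Arguments.
Unset Strict Implicit.

(** * Norm, real and imaginary parts in R[i] *)

Lemma norm_normc (R : rcfType) (z : R[i]) : `|z| = (normc z)%:C.
Proof. by case: z. Qed.

Lemma normc_ge0 (R : rcfType) (z : R[i]) : 0 <= normc z.
Proof. by case: z => a b; exact: sqrtr_ge0. Qed.

Lemma normc_real (R : rcfType) (x : R) : normc x%:C = `|x|.
Proof. by rewrite /= expr0n addr0 sqrtr_sqr. Qed.

Lemma normc_opp (R : rcfType) (z : R[i]) : normc (- z) = normc z.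
Proof. by apply: complexI; rewrite -!norm_normc normrN. Qed.

Lemma normc_conj (R : rcfType) (z : R[i]) : normc z^* = normc z.
Proof. by apply: complexI; rewrite -!norm_normc normcJ. Qed.

Lemma le_normc_add (R : rcfType) (y z : R[i]) :
  normc (y + z) <= normc y + normc z.
Proof. by rewrite -lecR rmorphD /= -!norm_normc ler_normD. Qed.

Lemma normr_Re_le (R : rcfType) (z : R[i]) : `|complex.Re z| <= normc z.
Proof. by rewrite -lecR -norm_normc normc_ge_Re. Qed.

Lemma normr_Im_le (R : rcfType) (z : R[i]) : `|complex.Im z| <= normc z.
Proof.
have := normr_Re_le (z * 'i%C); rewrite ReiNIm normrN normcM /=.
by rewrite expr0n expr1n add0r sqrtr1 mulr1.
Qed.

Lemma normc_le_ReIm (R : rcfType) (z : R[i]) :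
  normc z <= `|complex.Re z| + `|complex.Im z|.
Proof.
rewrite {1}[z]complexE; apply: le_trans (le_normc_add _ _) _.
by rewrite normcM !normc_real /= expr0n expr1n add0r sqrtr1 mul1r.
Qed.

Lemma gt0_complexE (R : rcfType) (z : R[i]) :
  0 < z -> z = (complex.Re z)%:C /\ 0 < complex.Re z.
Proof.
by rewrite ltcE /= => /andP[/eqP h ->]; split => //; move: h; case: z => a b /= ->.
Qed.

Lemma Re_add (R : rcfType) (y z : R[i]) :
  complex.Re (y + z) = complex.Re y + complex.Re z.
Proof. by case: y z => ? ? [? ?]. Qed.

Lemma Im_add (R : rcfType) (y z : R[i]) :
  complex.Im (y + z) = complex.Im y + complex.Im z.
Proof. by case: y z => ? ? [? ?]. Qed.

Lemma Re_opp (R : rcfType) (z : R[i]) : complex.Re (- z) = - complex.Re z.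
Proof. by case: z. Qed.

Lemma Im_opp (R : rcfType) (z : R[i]) : complex.Im (- z) = - complex.Im z.
Proof. by case: z. Qed.

(** * Geometric convergence *)

Lemma exprn_lt_eps (R : realType) (q e : R) :
  0 < q -> q < 1 -> 0 < e -> exists N, forall n, (N <= n)%N -> q ^+ n < e.
Proof.
move=> q0 q1 e0.
have /cvg_expr /cvgr0_norm_lt /(_ e e0) [N _ hN] : `|q| < 1 by rewrite gtr0_norm.
exists N => n /hN /=.
by rewrite ger0_norm // exprn_ge0 // ltW.
Qed.

(** Stands in for passing to the limit in an inequality: a positive [X - Y] would eventually exceed
    the error [K * q ^+ n]. *)
Lemma le_of_le_geometric (R : realType) (q K X Y : R) (N : nat) :
  0 < q -> q < 1 -> (forall n, (N <= n)%N -> X <= Y + K * q ^+ n) -> X <= Y.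
Proof.
move=> q0 q1 h; rewrite leNgt; apply/negP => YX.
(* The sign of [K] is unknown; [|K| + 1] is a positive upper bound for it, safe to divide by. *)
have K1 : 0 < `|K| + 1 by rewrite ltr_wpDl.
have [M hM] : exists M, forall n, (M <= n)%N -> q ^+ n < (X - Y) / (`|K| + 1).
  by apply: exprn_lt_eps => //; rewrite divr_gt0 ?subr_gt0.
have := h _ (leq_maxl N M); have := hM _ (leq_maxr N M).
rewrite ltr_pdivlMr // => h1 h2.
have h3 : K * q ^+ maxn N M <= q ^+ maxn N M * (`|K| + 1).
  rewrite mulrC ler_pM2l ?exprn_gt0 //; have := ler_norm K; lra.
by move: h1 h2 h3; lra.
Qed.

(** Convergence with an explicit rate. The partial products and sums below all converge like q^n,
    and the algebra of such limits reduces to inequalities between the real moduli [normc]. *)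
Definition geom_cvg (R : realType) (q : R) (u : nat -> R[i]) (l : R[i]) : Prop :=
  exists K : R, forall n, normc (u n - l) <= K * q ^+ n.

Lemma geom_cvg_unique (R : realType) (q : R) (u : nat -> R[i]) (l m : R[i]) :
  0 < q -> q < 1 -> geom_cvg q u l -> geom_cvg q u m -> l = m.
Proof.
move=> q0 q1 [K hK] [L hL]; apply/eqP; rewrite -subr_eq0; apply/eqP.
apply: eq0_normc; apply/eqP; rewrite eq_le normc_ge0 andbT.
apply: (@le_of_le_geometric R q (K + L) _ _ 0) => // n _; rewrite add0r mulrDl.
apply: le_trans (lerD (hK n) (hL n)).
rewrite -(normc_opp (u n - l)); apply: le_trans (le_normc_add _ _).
by rewrite le_eqVlt; apply/orP; left; apply/eqP; congr normc; ring.
Qed.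

Lemma geom_cvg_bounded (R : realType) (q : R) (u : nat -> R[i]) (l : R[i]) :
  0 < q -> q < 1 -> geom_cvg q u l -> exists B : R, forall n, normc (u n) <= B.
Proof.
move=> q0 q1 [K hK]; exists (`|K| + normc l) => n.
rewrite -[u n](subrK l); apply: le_trans (le_normc_add _ _) _.
rewrite lerD2r; apply: le_trans (hK n) _.
apply: le_trans (ler_norm _) _; rewrite normrM ler_piMr //.
by rewrite ger0_norm ?exprn_ge0 ?exprn_ile1 // ltW.
Qed.

Lemma geom_cvg_shift (R : realType) (q : R) (u : nat -> R[i]) (l : R[i]) :
  geom_cvg q u l -> geom_cvg q (fun n => u n.+1) l.
Proof.
by move=> [K hK]; exists (K * q) => n; rewrite -mulrA -exprS.
Qed.

Lemma geom_cvgD (R : realType) (q : R) (u v : nat -> R[i]) (l m : R[i]) :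
  geom_cvg q u l -> geom_cvg q v m -> geom_cvg q (fun n => u n + v n) (l + m).
Proof.
move=> [K hK] [L hL]; exists (K + L) => n; rewrite mulrDl.
apply: le_trans (lerD (hK n) (hL n)); rewrite opprD addrACA.
exact: le_normc_add.
Qed.

Lemma geom_cvgM (R : realType) (q : R) (u v : nat -> R[i]) (l m : R[i]) :
  0 < q -> q < 1 ->
  geom_cvg q u l -> geom_cvg q v m -> geom_cvg q (fun n => u n * v n) (l * m).
Proof.
move=> q0 q1 cu cv; have [B hB] := geom_cvg_bounded q0 q1 cu.
case: cu cv => [K hK] [L hL]; exists (B * L + normc m * K) => n.
have -> : u n * v n - l * m = u n * (v n - m) + m * (u n - l) by ring.
apply: le_trans (le_normc_add _ _) _; rewrite !normcM mulrDl -!mulrA.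
apply: lerD; last by rewrite ler_wpM2l ?normc_ge0.
by apply: ler_pM; rewrite ?normc_ge0.
Qed.

Lemma geom_cvgMl (R : realType) (q : R) (u : nat -> R[i]) (l c : R[i]) :
  geom_cvg q u l -> geom_cvg q (fun n => c * u n) (c * l).
Proof.
move=> [K hK]; exists (normc c * K) => n; rewrite -mulrBr normcM -mulrA.
by rewrite ler_wpM2l ?normc_ge0.
Qed.

Lemma geom_cvgN (R : realType) (q : R) (u : nat -> R[i]) (l : R[i]) :
  geom_cvg q u l -> geom_cvg q (fun n => - u n) (- l).
Proof. by move=> [K hK]; exists K => n; rewrite -opprD normc_opp. Qed.

Lemma geom_cvg_conj (R : realType) (q : R) (u : nat -> R[i]) (l : R[i]) :
  geom_cvg q u l -> geom_cvg q (fun n => (u n)^*) l^*.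
Proof. by move=> [K hK]; exists K => n; rewrite -rmorphB normc_conj. Qed.

Lemma geom_cvg_normc_le (R : realType) (q : R) (u : nat -> R[i]) (l : R[i])
    (B : R) :
  0 < q -> q < 1 -> geom_cvg q u l -> (forall n, normc (u n) <= B) ->
  normc l <= B.
Proof.
move=> q0 q1 [K hK] hB; apply: (@le_of_le_geometric _ q K _ _ 0) => // n _.
have -> : l = u n + - (u n - l) by ring.
apply: le_trans (le_normc_add _ _) _.
by rewrite normc_opp lerD.
Qed.

(** The bound is asked only from [N] on because a given term of a series enters the partial sums
    only from some index on. *)
Lemma geom_cvg_Re_le (R : realType) (q : R) (u : nat -> R[i]) (l : R[i])
    (B : R) (N : nat) :
  0 < q -> q < 1 -> geom_cvg q u l ->
  (forall n, (N <= n)%N -> complex.Re (u n) <= B) -> complex.Re l <= B.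
Proof.
move=> q0 q1 [K hK] hB; apply: (@le_of_le_geometric R q K _ _ N) => // n Nn.
have := hB n Nn; have := le_trans (normr_Re_le _) (hK n).
rewrite Re_add Re_opp ler_norml => /andP[]; lra.
Qed.

(* Adding or subtracting the tail K q^n / (1 - q) turns u into a nonincreasing,
   respectively nondecreasing, sequence; these enclose the limit. *)
Lemma real_geom_cauchy (R : realType) (q K : R) (u : nat -> R) :
  0 < q -> q < 1 -> (forall n, `|u n.+1 - u n| <= K * q ^+ n) ->
  exists l, forall n, `|u n - l| <= K / (1 - q) * q ^+ n.
Proof.
move=> q0 q1 hu; set M := K / (1 - q).
have hM : M * (1 - q) = K by rewrite mulfVK // subr_eq0 gt_eqF.
pose lo n := u n - M * q ^+ n; pose hi n := u n + M * q ^+ n.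
have step n : lo n <= lo n.+1 /\ hi n.+1 <= hi n.
  have := hu n; rewrite /lo /hi exprS -hM ler_norml => /andP[h1 h2].
  by split; lra.
have lo_mono : {homo lo : m n / (m <= n)%N >-> m <= n}.
  by apply: homo_leq => [x|y x z|k]; [|exact: le_trans|case: (step k)].
have hi_mono : {homo hi : m n / (m <= n)%N >-> n <= m}.
  apply: homo_leq => [x|y x z|k]; first by [].
    by move=> h1 h2; apply: le_trans h2 h1.
  by case: (step k).
have K0 : 0 <= K by have := hu 0%N; rewrite expr0 mulr1; apply: le_trans.
have M0 : 0 <= M by rewrite divr_ge0 // subr_ge0 ltW.
have lo_hi m n : lo m <= hi n.
  apply: le_trans (lo_mono _ _ (leq_maxl m n)) _.
  apply: le_trans (hi_mono _ _ (leq_maxr m n)).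
  have : 0 <= M * q ^+ maxn m n by rewrite mulr_ge0 // exprn_ge0 // ltW.
  by rewrite /lo /hi; lra.
exists (sup [set lo n | n in setT]) => n.
have h1 : lo n <= sup [set lo n | n in setT].
  apply: ub_le_sup; last by exists n.
  by exists (hi 0%N) => _ [m _ <-]; exact: lo_hi.
have h2 : sup [set lo n | n in setT] <= hi n.
  apply: ge_sup; first by exists (lo 0%N), 0%N.
  by move=> _ [m _ <-]; exact: lo_hi.
rewrite ler_norml; apply/andP; move: h1 h2; rewrite /lo /hi.
by split; lra.
Qed.

(** Real and imaginary parts converge separately, and their two error bounds add up. *)
Lemma geom_cauchy_cvg (R : realType) (q K : R) (u : nat -> R[i]) :
  0 < q -> q < 1 -> (forall n, normc (u n.+1 - u n) <= K * q ^+ n) ->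
  exists l, geom_cvg q u l.
Proof.
move=> q0 q1 hu.
have [l hl] : exists l, forall n,
    `|complex.Re (u n) - l| <= K / (1 - q) * q ^+ n.
  apply: real_geom_cauchy => // n; rewrite -Re_opp -Re_add.
  exact: le_trans (normr_Re_le _) (hu n).
have [m hm] : exists m, forall n,
    `|complex.Im (u n) - m| <= K / (1 - q) * q ^+ n.
  apply: real_geom_cauchy => // n; rewrite -Im_opp -Im_add.
  exact: le_trans (normr_Im_le _) (hu n).
exists (l +i* m), (K / (1 - q) + K / (1 - q)) => n.
apply: le_trans (normc_le_ReIm _) _.
by rewrite mulrDl Re_add Im_add Re_opp Im_opp lerD.
Qed.

(** Connects the explicit rate with the topological limit in the definition of [qpoch_inf]. *)
Lemma geom_cvg_lim (R : realType) (q : R) (u : nat -> R[i]) (l : R[i]) :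
  0 < q -> q < 1 -> geom_cvg q u l -> limn (u : nat -> R[i]^o) = l.
Proof.
move=> q0 q1 [K hK]; apply: cvg_lim; first exact: norm_hausdorff.
(* In the order of [R[i]], a positive [e] is a positive real number. *)
apply/cvgrPdist_le => e e0; have [e1 e2] := gt0_complexE e0.
have K1 : 0 < `|K| + 1 by rewrite ltr_wpDl.
have [N hN] : exists N, forall n, (N <= n)%N -> q ^+ n < complex.Re e / (`|K| + 1).
  by apply: exprn_lt_eps => //; rewrite divr_gt0.
exists N => // n /= /hN; rewrite ltr_pdivlMr // => h1.
rewrite -opprB normrN norm_normc e1 lecR.
apply: le_trans (hK n) _.
have h3 : K * q ^+ n <= q ^+ n * (`|K| + 1).
  rewrite mulrC ler_pM2l ?exprn_gt0 //; have := ler_norm K; lra.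
exact: le_trans h3 (ltW h1).
Qed.

(** * The infinite q-Pochhammer symbol *)

Definition qpoch (R : realType) (x : R[i]) (q : R) (n : nat) : R[i] :=
  \prod_(j < n) (1 - x * q%:C ^+ j).

(** The q-integer (1 - q^n) / (1 - q). It collects the weights q^j in the exponents of the bounds
    below, which [qnat_le] makes uniform in [n]. *)
Definition qnat (R : realType) (q : R) (n : nat) : R := \sum_(j < n) q ^+ j.

Lemma qpochS (R : realType) (x : R[i]) (q : R) (n : nat) :
  qpoch x q n.+1 = qpoch x q n * (1 - x * (q ^+ n)%:C).
Proof. by rewrite /qpoch big_ord_recr /= rmorphXn. Qed.

Lemma qpochSl (R : realType) (x : R[i]) (q : R) (n : nat) :
  qpoch x q n.+1 = (1 - x) * qpoch (x * q%:C) q n.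
Proof.
rewrite /qpoch big_ord_recl /= expr0 mulr1; congr (_ * _).
by apply: eq_bigr => j _; rewrite /= exprS mulrA.
Qed.

Lemma qnatS (R : realType) (q : R) (n : nat) :
  qnat q n.+1 = qnat q n + q ^+ n.
Proof. by rewrite /qnat big_ord_recr. Qed.

Lemma qnat_ge0 (R : realType) (q : R) (n : nat) : 0 < q -> 0 <= qnat q n.
Proof. by move=> q0; apply: sumr_ge0 => j _; rewrite exprn_ge0 // ltW. Qed.

Lemma qnat_le (R : realType) (q : R) (n : nat) :
  0 < q -> q < 1 -> qnat q n <= (1 - q)^-1.
Proof.
move=> q0 q1; rewrite -[leRHS]mul1r ler_pdivlMr ?subr_gt0 //.
suff -> : qnat q n * (1 - q) = 1 - q ^+ n.
  by have := exprn_gt0 n q0; lra.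
elim: n => [|n IH]; first by rewrite /qnat big_ord0 expr0 mul0r subrr.
by rewrite qnatS mulrDl IH exprS; ring.
Qed.

Lemma normc_scale (R : realType) (x : R[i]) (t : R) :
  0 <= t -> normc (x * t%:C) = normc x * t.
Proof. by move=> t0; rewrite normcM normc_real ger0_norm. Qed.

(** From 1 + r t <= exp(r t); bounds on products thus become sums in an exponent. *)
Lemma normc_factor_le (R : realType) (x : R[i]) (t r : R) :
  0 <= t -> normc x <= r -> normc (1 - x * t%:C) <= expR (r * t).
Proof.
move=> t0 xr; apply: le_trans (expR_ge1Dx _).
apply: le_trans (le_normc_add _ _) _.
by rewrite normc1 normc_opp normc_scale // lerD2l ler_wpM2r.
Qed.

Lemma qpoch_normc_le (R : realType) (x : R[i]) (q r : R) (n : nat) :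
  0 < q -> normc x <= r -> normc (qpoch x q n) <= expR (r * qnat q n).
Proof.
move=> q0 xr; elim: n => [|n IH].
  by rewrite /qpoch /qnat !big_ord0 mulr0 expR0 normc1.
rewrite qpochS qnatS (mulrDr r) expRD normcM.
apply: ler_pM; rewrite ?normc_ge0 //.
by rewrite normc_factor_le // exprn_ge0 // ltW.
Qed.

(** Induction with the discrete product rule: the new difference is the old one times the new
    factor, minus the old product times [h * t]. The two parts account for [qnat q n] and for its
    increment q^n. *)
Lemma qpoch_lipschitz (R : realType) (x h : R[i]) (q r : R) (n : nat) :
  0 < q -> normc x <= r -> normc (x + h) <= r ->
  normc (qpoch (x + h) q n - qpoch x q n) <=
  normc h * qnat q n * expR (r * qnat q n).
Proof.
move=> q0 xr xhr; elim: n => [|n IH].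
  by rewrite /qpoch /qnat !big_ord0 subrr normc0 mulr0 mul0r.
rewrite !qpochS qnatS; set t := q ^+ n; set u := qpoch _ _ _ in IH *.
set v := qpoch _ _ _ in IH *.
have t0 : 0 <= t by rewrite exprn_ge0 // ltW.
have r0 : 0 <= r by apply: le_trans xr; apply: normc_ge0.
have -> : u * (1 - (x + h) * t%:C) - v * (1 - x * t%:C) =
          (u - v) * (1 - (x + h) * t%:C) + - (v * (h * t%:C)) by ring.
apply: le_trans (le_normc_add _ _) _; rewrite normc_opp !normcM.
rewrite mulrDr mulrDl; apply: lerD.
  rewrite (mulrDr r) expRD mulrA; apply: ler_pM; rewrite ?normc_ge0 //.
  exact: normc_factor_le.
rewrite normc_real ger0_norm // mulrC ler_wpM2l ?mulr_ge0 ?normc_ge0 //.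
apply: le_trans (qpoch_normc_le n q0 xr) _.
by rewrite ler_expR ler_wpM2l // lerDl.
Qed.

(* The n-th partial sum of the logarithmic derivative of x |-> (x; q)_oo. *)
Definition qlogder (R : realType) (x : R[i]) (q : R) (n : nat) : R[i] :=
  \sum_(j < n) (- (q ^+ j)%:C / (1 - x * (q ^+ j)%:C)).

(** Induction again: the new remainder is the old one times the new factor, minus (u - v) h t, which
    [qpoch_lipschitz] shows to be of second order in [h]. Nonvanishing factors allow the derivative
    to be written as product times logarithmic derivative. *)
Lemma qpoch_taylor (R : realType) (x h : R[i]) (q r : R) (n : nat) :
  0 < q -> (forall j, 1 - x * (q ^+ j)%:C != 0) ->
  normc x <= r -> normc (x + h) <= r ->
  normc (qpoch (x + h) q n - qpoch x q n - h * (qpoch x q n * qlogder x q n)) <=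
  normc h ^+ 2 * qnat q n ^+ 2 * expR (r * qnat q n).
Proof.
move=> q0 x0 xr xhr; elim: n => [|n IH].
  rewrite /qpoch /qlogder /qnat !big_ord0 subrr mulr0 mulr0 subrr normc0.
  by rewrite expr0n mulr0 mul0r.
have lip := qpoch_lipschitz n q0 xr xhr.
rewrite !qpochS qnatS /qlogder big_ord_recr /= -/(qlogder x q n).
set t := q ^+ n; set u := qpoch _ _ _ in IH lip *;
set v := qpoch _ _ _ in IH lip *.
have t0 : 0 <= t by rewrite exprn_ge0 // ltW.
have r0 : 0 <= r by apply: le_trans xr; apply: normc_ge0.
have s0 := qnat_ge0 n q0.
have -> : u * (1 - (x + h) * t%:C) - v * (1 - x * t%:C) -
     h * (v * (1 - x * t%:C) * (qlogder x q n + - t%:C / (1 - x * t%:C))) =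
  (u - v - h * (v * qlogder x q n)) * (1 - x * t%:C) + - ((u - v) * (h * t%:C)).
  by have := x0 n; rewrite -/t => ?; field.
apply: le_trans (le_normc_add _ _) _;
rewrite normc_opp !normcM normc_real ger0_norm //.
set s := qnat q n in IH lip s0 *; set E := expR (r * s) in IH lip *.
rewrite (mulrDr r) expRD -/E; set F := expR (r * t).
have E0 : 0 <= E by apply: expR_ge0.
have F1 : 1 <= F by rewrite -expR0 ler_expR mulr_ge0.
have h0 := normc_ge0 h.
have b1 : normc (1 - x * t%:C) <= F by apply: normc_factor_le.
(* Of (s + t)^2, the part s^2 pays for the old remainder and one s t for the cross term; the rest is
   nonnegative slack. *)
have -> : normc h ^+ 2 * (s + t) ^+ 2 * (E * F) =
  normc h ^+ 2 * s ^+ 2 * E * F +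
  (normc h ^+ 2 * s * t * E * F + normc h ^+ 2 * (s * t + t * t) * (E * F)) by ring.
apply: lerD; first by apply: ler_pM; rewrite ?normc_ge0.
have e2 : 0 <= normc h ^+ 2 * (s * t + t * t) * (E * F).
  by rewrite !mulr_ge0 ?addr_ge0 ?mulr_ge0 // (le_trans ler01).
have e3 : normc h * s * E * (normc h * t) <= normc h ^+ 2 * s * t * E * F.
  have -> : normc h * s * E * (normc h * t) = normc h ^+ 2 * s * t * E by ring.
  by rewrite ler_peMr // !mulr_ge0.
rewrite -[leLHS]addr0; apply: lerD => //; apply: le_trans e3.
by rewrite ler_wpM2r ?mulr_ge0.
Qed.

(** Consecutive partial products differ by [x * q ^+ n] times a partial product, and these are
    bounded by exp(|x| / (1 - q)). *)
Lemma qpoch_inf_cvg (R : realType) (x : R[i]) (q : R) :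
  0 < q -> q < 1 -> geom_cvg q (qpoch x q) (qpoch_inf x q).
Proof.
move=> q0 q1.
have [l hl] : exists l, geom_cvg q (qpoch x q) l.
  apply: (geom_cauchy_cvg (K := expR (normc x / (1 - q)) * normc x)) => // n.
  have -> : qpoch x q n.+1 - qpoch x q n = - (qpoch x q n * (x * (q ^+ n)%:C)).
    by rewrite qpochS; ring.
  have t0 : 0 <= q ^+ n by rewrite exprn_ge0 // ltW.
  rewrite normc_opp normcM normc_scale // -mulrA.
  rewrite ler_wpM2r ?mulr_ge0 ?normc_ge0 //.
  apply: le_trans (qpoch_normc_le n q0 (lexx _)) _.
  by rewrite ler_expR ler_wpM2l ?normc_ge0 // qnat_le.
by rewrite /qpoch_inf (geom_cvg_lim q0 q1 hl).
Qed.

Lemma qpoch_inf_lipschitz (R : realType) (x h : R[i]) (q r : R) :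
  0 < q -> q < 1 -> normc x <= r -> normc (x + h) <= r ->
  normc (qpoch_inf (x + h) q - qpoch_inf x q) <=
  normc h * ((1 - q)^-1 * expR (r / (1 - q))).
Proof.
move=> q0 q1 xr xhr.
have r0 : 0 <= r by apply: le_trans xr; apply: normc_ge0.
apply: (@geom_cvg_normc_le _ q (fun n => qpoch (x + h) q n - qpoch x q n)) => //.
  apply: geom_cvgD; first exact: qpoch_inf_cvg.
  by apply: geom_cvgN; exact: qpoch_inf_cvg.
move=> n; apply: le_trans (qpoch_lipschitz n q0 xr xhr) _.
rewrite -mulrA ler_wpM2l ?normc_ge0 //.
by apply: ler_pM; rewrite ?qnat_ge0 ?expR_ge0 ?ler_expR ?ler_wpM2l ?qnat_le.
Qed.

(** The finite estimate survives the limit because [qnat q n] never exceeds 1 / (1 - q). *)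
Lemma qpoch_inf_taylor (R : realType) (x h L : R[i]) (q r : R) :
  0 < q -> q < 1 -> (forall j, 1 - x * (q ^+ j)%:C != 0) ->
  geom_cvg q (qlogder x q) L ->
  normc x <= r -> normc (x + h) <= r ->
  normc (qpoch_inf (x + h) q - qpoch_inf x q - h * (qpoch_inf x q * L)) <=
  normc h ^+ 2 * ((1 - q)^-1 ^+ 2 * expR (r / (1 - q))).
Proof.
move=> q0 q1 x0 hL xr xhr.
have r0 : 0 <= r by apply: le_trans xr; apply: normc_ge0.
apply: (@geom_cvg_normc_le _ q (fun n => qpoch (x + h) q n - qpoch x q n -
    h * (qpoch x q n * qlogder x q n))) => //.
  apply: geom_cvgD; last apply: geom_cvgN.
    apply: geom_cvgD; first exact: qpoch_inf_cvg.
    by apply: geom_cvgN; exact: qpoch_inf_cvg.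
  by apply/geom_cvgMl/geom_cvgM => //; exact: qpoch_inf_cvg.
move=> n; apply: le_trans (qpoch_taylor n q0 x0 xr xhr) _.
rewrite -mulrA ler_wpM2l ?exprn_ge0 ?normc_ge0 //.
apply: ler_pM; rewrite ?exprn_ge0 ?qnat_ge0 ?expR_ge0 ?ler_expR ?ler_wpM2l ?qnat_le //.
by rewrite lerXn2r ?nnegrE ?qnat_ge0 ?qnat_le // invr_ge0 subr_ge0 ltW.
Qed.

Lemma qpoch_inf_funeq (R : realType) (x : R[i]) (q : R) :
  0 < q -> q < 1 -> qpoch_inf x q = (1 - x) * qpoch_inf (x * q%:C) q.
Proof.
move=> q0 q1.
apply: (geom_cvg_unique q0 q1 (geom_cvg_shift (qpoch_inf_cvg x q0 q1))).
have /(geom_cvgMl (1 - x)) [K hK] := qpoch_inf_cvg (x * q%:C) q0 q1.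
by exists K => n; rewrite qpochSl.
Qed.

Lemma qpoch_inf0 (R : realType) (q : R) :
  0 < q -> q < 1 -> qpoch_inf (0 : R[i]) q = 1.
Proof.
move=> q0 q1; apply: (geom_cvg_unique q0 q1 (qpoch_inf_cvg 0 q0 q1)).
exists 0 => n; rewrite /qpoch big1 ?subrr ?normc0 ?mul0r // => j _.
by rewrite mul0r subr0.
Qed.

(** Since q is real, conjugation acts factor by factor. This makes E_q(iz) and E_q(-iz) conjugate
    for real z. *)
Lemma qpoch_inf_conj (R : realType) (x : R[i]) (q : R) :
  0 < q -> q < 1 -> qpoch_inf x^* q = (qpoch_inf x q)^*.
Proof.
move=> q0 q1; apply: (geom_cvg_unique q0 q1 (qpoch_inf_cvg x^* q0 q1)).
have [K hK] := geom_cvg_conj (qpoch_inf_cvg x q0 q1).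
exists K => n; apply: le_trans (hK n); rewrite le_eqVlt; apply/orP; left.
apply/eqP; congr (normc (_ - _)); rewrite /qpoch rmorph_prod.
by apply: eq_bigr => j _; rewrite rmorphB rmorph1 rmorphM rmorphXn /= oppr0.
Qed.

(** * The logarithmic derivative on the imaginary axis *)

Lemma qlogder_cvg (R : realType) (x : R[i]) (q : R) :
  0 < q -> q < 1 -> complex.Re x = 0 ->
  exists L, geom_cvg q (qlogder x q) L.
Proof.
move=> q0 q1; case: x => a t /= ->; apply: (geom_cauchy_cvg (K := 1)) => // n.
rewrite /qlogder big_ord_recr /= addrAC subrr add0r mul1r normcM normcV normc_opp.
have t0 : 0 < q ^+ n by rewrite exprn_gt0.
(* For imaginary x the denominator has real part 1, so the n-th term has modulus at most q^n. *)
have d1 : 1 <= normc (1 - t*i * (q ^+ n)%:C).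
  by apply: le_trans (normr_Re_le _); rewrite /= !mul0r mulr0 subr0 subr0 normr1.
rewrite normc_real gtr0_norm // ler_pdivrMr ?(lt_le_trans ltr01) //.
by rewrite ler_peMr // ltW.
Qed.

Lemma qlogder_conj (R : realType) (x : R[i]) (q : R) (n : nat) :
  qlogder x^* q n = (qlogder x q n)^*.
Proof.
rewrite /qlogder rmorph_sum; apply: eq_bigr => j _.
by rewrite rmorphM rmorphN fmorphV rmorphB rmorph1 rmorphM /= oppr0.
Qed.

Lemma factor_neq0 (R : realType) (s t : R) : 1 - (0 -i* s) * t%:C != 0.
Proof.
rewrite eq_complex negb_and; apply/orP; left => /=.
by rewrite mul0r mulr0 subr0 subr0 oner_eq0.
Qed.

Lemma Re_qlogder_term (R : realType) (s t : R) :
  complex.Re (- t%:C / (1 - (0 -i* s) * t%:C)) = - (t / (1 + (s * t) ^+ 2)).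
Proof.
have d0 : 1 + (s * t) ^+ 2 != 0 by rewrite gt_eqF // ltr_pwDl // sqr_ge0.
have -> : - t%:C / (1 - (0 -i* s) * t%:C) =
    (- (t / (1 + (s * t) ^+ 2))) +i* (s * t ^+ 2 / (1 + (s * t) ^+ 2)).
  apply: (mulIf (factor_neq0 s t)); rewrite divfK ?factor_neq0 //.
  by apply/eqP; rewrite eq_complex /=; apply/andP; split; apply/eqP; field.
by [].
Qed.

(** All terms of the series have nonpositive real part, so discarding all but the j-th can only
    increase the sum; that term is present in the partial sums from n = j + 1 on. *)
Lemma Re_qlogder_le (R : realType) (s q : R) (L : R[i]) (j : nat) :
  0 < q -> q < 1 -> geom_cvg q (qlogder (0 -i* s) q) L ->
  complex.Re L <= - (q ^+ j / (1 + (s * q ^+ j) ^+ 2)).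
Proof.
move=> q0 q1 hL; apply: (geom_cvg_Re_le (N := j.+1) q0 q1 hL) => n jn.
rewrite /qlogder (big_morph _ (@Re_add R) (erefl : complex.Re (0 : R[i]) = 0)).
rewrite (bigD1 (Ordinal jn)) // -[leRHS]addr0.
apply: lerD; first by rewrite Re_qlogder_term.
apply: sumr_le0 => k _; rewrite Re_qlogder_term oppr_le0.
by rewrite divr_ge0 ?exprn_ge0 ?addr_ge0 ?sqr_ge0 // ltW.
Qed.

(** * Complex derivatives *)

(** Differentiability with a second-order remainder on the unit disc: the form that
    [qpoch_inf_taylor] provides, stable under linear combinations without any limit argument. *)
Definition quad_cderiv (R : realType) (f : R[i] -> R[i]) (z l : R[i]) : Prop :=
  exists K : R, forall h : R[i], normc h <= 1 ->
    normc (f (z + h) - f z - h * l) <= K * normc h ^+ 2.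

Lemma quad_cderivE (R : realType) (f : R[i] -> R[i]) (z l : R[i]) :
  quad_cderiv f z l -> cderiv f z = l.
Proof.
move=> [K hK]; rewrite /cderiv /derive1; apply: (@cvg_lim R[i]^o).
  exact: norm_hausdorff.
apply/cvgrPdist_le => e e0; have [e1 e2] := gt0_complexE e0.
have K1 : 0 < `|K| + 1 by rewrite ltr_wpDl.
(* The bound 1 makes the quadratic estimate available; the other one makes [K * normc h] at most
   [e]. *)
set d := Num.min 1 (complex.Re e / (`|K| + 1)).
have d0 : 0 < d by rewrite lt_min ltr01 divr_gt0.
exists d%:C => /=; first by rewrite ltcR.
move=> h /=; rewrite sub0r normrN norm_normc ltcR => hd h0.
have nh0 : 0 < normc h.
  by rewrite lt_neqAle normc_ge0 andbT eq_sym; apply: contra h0 => /eqP /eq0_normc ->.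
have [h1 h2] : normc h < 1 /\ normc h < complex.Re e / (`|K| + 1).
  by move: hd; rewrite lt_min => /andP[].
have := hK h (ltW h1); rewrite e1 norm_normc lecR.
have -> : l - h^-1 *: (f (h + z) - f z) = - (h^-1 * (f (z + h) - f z - h * l)).
  rewrite (addrC h z) -[_ *: _]/(h^-1 * (f (z + h) - f z)).
  by field.
rewrite normc_opp normcM normcV => h3.
rewrite ler_pdivrMl //; apply: le_trans h3 _.
rewrite expr2 mulrCA ler_wpM2l ?normc_ge0 //.
move: h2; rewrite ltr_pdivlMr // => h2; apply: le_trans (ltW h2).
rewrite mulrC ler_wpM2l ?normc_ge0 //; have := ler_norm K; lra.
Qed.

Lemma quad_cderivD (R : realType) (f g : R[i] -> R[i]) (z l m : R[i]) :
  quad_cderiv f z l -> quad_cderiv g z m ->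
  quad_cderiv (fun x => f x + g x) z (l + m).
Proof.
move=> [K hK] [M hM]; exists (K + M) => h h1; rewrite mulrDl.
apply: le_trans (lerD (hK h h1) (hM h h1)).
apply: le_trans (le_normc_add _ _); rewrite le_eqVlt; apply/orP; left.
by apply/eqP; congr normc; ring.
Qed.

Lemma quad_cderivMl (R : realType) (f : R[i] -> R[i]) (c z l : R[i]) :
  quad_cderiv f z l -> quad_cderiv (fun x => c * f x) z (c * l).
Proof.
move=> [K hK]; exists (normc c * K) => h h1.
have -> : c * f (z + h) - c * f z - h * (c * l) =
          c * (f (z + h) - f z - h * l) by ring.
by rewrite normcM -mulrA ler_wpM2l ?normc_ge0 // hK.
Qed.

Lemma qpoch_inf_cderiv (R : realType) (q : R) (c z L : R[i]) :
  0 < q -> q < 1 -> (forall j, 1 - c * z * (q ^+ j)%:C != 0) ->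
  geom_cvg q (qlogder (c * z) q) L ->
  quad_cderiv (fun w => qpoch_inf (c * w) q) z (c * (qpoch_inf (c * z) q * L)).
Proof.
(* This radius covers both [c * z] and [c * (z + h)] as long as |h| <= 1. *)
move=> q0 q1 hz hL; set r := normc (c * z) + normc c.
exists (normc c ^+ 2 * ((1 - q)^-1 ^+ 2 * expR (r / (1 - q)))) => h h1.
rewrite mulrDr mulrCA mulrA.
have -> : normc c ^+ 2 * ((1 - q)^-1 ^+ 2 * expR (r / (1 - q))) * normc h ^+ 2 =
    normc (c * h) ^+ 2 * ((1 - q)^-1 ^+ 2 * expR (r / (1 - q))).
  by rewrite normcM; ring.
apply: qpoch_inf_taylor => //; first by rewrite lerDl normc_ge0.
apply: le_trans (le_normc_add _ _) _.
by rewrite lerD2l normcM ler_piMr ?normc_ge0.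
Qed.

(** * Values and derivatives of [Sin_q] and [Cos_q] on the real line *)

Lemma imag_argE (R : realType) (q x : R) :
  - (1 - q%:C) * 'i%C * x%:C = 0 -i* ((1 - q) * x).
Proof. by apply/eqP; rewrite eq_complex /=; apply/andP; split; apply/eqP; ring. Qed.

Lemma imag_argNE (R : realType) (q x : R) :
  - (1 - q%:C) * - 'i%C * x%:C = (0 -i* ((1 - q) * x))^*.
Proof. by apply/eqP; rewrite eq_complex /=; apply/andP; split; apply/eqP; ring. Qed.

Lemma im_neq0 (R : realType) : ('i%C : R[i]) != 0.
Proof. by rewrite eq_complex /= oner_eq0 andbF. Qed.

Lemma Sin_q_real (R : realType) (q x : R) : 0 < q -> q < 1 ->
  Sin_q q x%:C = (complex.Im (qpoch_inf (0 -i* ((1 - q) * x)) q))%:C.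
Proof.
move=> q0 q1; rewrite /Sin_q /E_q !mulrA imag_argE imag_argNE.
rewrite qpoch_inf_conj // subcJ; set s := (_%:C)%C.
by field; exact: im_neq0.
Qed.

Lemma Cos_q_real (R : realType) (q x : R) : 0 < q -> q < 1 ->
  Cos_q q x%:C = (complex.Re (qpoch_inf (0 -i* ((1 - q) * x)) q))%:C.
Proof.
move=> q0 q1; rewrite /Cos_q /E_q !mulrA imag_argE imag_argNE.
by rewrite qpoch_inf_conj // ReJ_add.
Qed.

(** The second argument is the conjugate of the first, so its product and its logarithmic derivative
    are the conjugates too; only the inner derivative changes sign. *)
Lemma E_q_imag_cderiv (R : realType) (q x : R) (L : R[i]) :
  0 < q -> q < 1 -> geom_cvg q (qlogder (0 -i* ((1 - q) * x)) q) L ->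
  let D := qpoch_inf (0 -i* ((1 - q) * x)) q * L in
  quad_cderiv (fun z => E_q q ('i%C * z)) x%:C (- (1 - q%:C) * 'i%C * D) /\
  quad_cderiv (fun z => E_q q (- 'i%C * z)) x%:C (- (1 - q%:C) * - 'i%C * conjc D).
Proof.
move=> q0 q1 hL D; rewrite /E_q.
rewrite (_ : (fun z => _) = fun z => qpoch_inf (- (1 - q%:C) * 'i%C * z) q); last first.
  by apply/funext => z; rewrite mulrA.
rewrite (_ : (fun z => qpoch_inf (_ * (- _ * _)) _) =
    fun z => qpoch_inf (- (1 - q%:C) * - 'i%C * z) q); last first.
  by apply/funext => z; rewrite mulrA.
split.
  rewrite /D -imag_argE; apply: qpoch_inf_cderiv => //; rewrite imag_argE //.
  by move=> j; apply: factor_neq0.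
have -> : conjc D = qpoch_inf (conjc (0 -i* ((1 - q) * x))) q * conjc L.
  by rewrite qpoch_inf_conj //; exact: (rmorphM (@conjc R)).
rewrite -imag_argNE.
apply: qpoch_inf_cderiv => //; rewrite imag_argNE.
  (* The conjugate of [0 -i* s] is convertible to [0 -i* (- s)]. *)
  by move=> j; exact: (factor_neq0 (- ((1 - q) * x))).
have [K hK] := geom_cvg_conj hL.
by exists K => n; rewrite qlogder_conj.
Qed.

(** Subtracting the two derivatives leaves -(1-q) i (D + conj D), and D + conj D = 2 Re D. *)
Lemma cderiv_Sin_q (R : realType) (q x : R) (L : R[i]) :
  0 < q -> q < 1 -> geom_cvg q (qlogder (0 -i* ((1 - q) * x)) q) L ->
  cderiv (Sin_q q) x%:C =
  (- ((1 - q) * complex.Re (qpoch_inf (0 -i* ((1 - q) * x)) q * L)))%:C.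
Proof.
move=> q0 q1 hL; have [h1 h2] := E_q_imag_cderiv q0 q1 hL.
set D := (_ * L) in h1 h2 *.
have := quad_cderivMl (2 * 'i%C)^-1 (quad_cderivD h1 (quad_cderivMl (-1) h2)).
move=> /quad_cderivE h.
have -> : Sin_q q = fun z =>
    (2 * 'i%C)^-1 * (E_q q ('i%C * z) + -1 * E_q q (- 'i%C * z)).
  by apply/funext => z; rewrite /Sin_q mulrC mulN1r.
have -> : (- ((1 - q) * complex.Re D))%:C = - ((1 - q%:C) * (complex.Re D)%:C).
  by rewrite rmorphN rmorphM rmorphB.
rewrite h ReJ_add.
by field; exact: im_neq0.
Qed.

(** Here the sum gives -(1-q) i (D - conj D), and D - conj D = 2 i Im D. *)
Lemma cderiv_Cos_q (R : realType) (q x : R) (L : R[i]) :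
  0 < q -> q < 1 -> geom_cvg q (qlogder (0 -i* ((1 - q) * x)) q) L ->
  cderiv (Cos_q q) x%:C =
  ((1 - q) * complex.Im (qpoch_inf (0 -i* ((1 - q) * x)) q * L))%:C.
Proof.
move=> q0 q1 hL; have [h1 h2] := E_q_imag_cderiv q0 q1 hL.
set D := (_ * L) in h1 h2 *.
have := quad_cderivMl 2^-1 (quad_cderivD h1 h2).
move=> /quad_cderivE h.
have -> : Cos_q q = fun z => 2^-1 * (E_q q ('i%C * z) + E_q q (- 'i%C * z)).
  by apply/funext => z; rewrite /Cos_q mulrC.
have -> : ((1 - q) * complex.Im D)%:C = (1 - q%:C) * (complex.Im D)%:C.
  by rewrite rmorphM rmorphB.
rewrite h ImJ_sub.
by field.
Qed.

(** * Location of the zeros *)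

Lemma qpoch_inf_imag_funeq (R : realType) (q t : R) : 0 < q -> q < 1 ->
  qpoch_inf (0 -i* t) q = (1 +i* t) * qpoch_inf (0 -i* (t * q)) q.
Proof.
move=> q0 q1; rewrite qpoch_inf_funeq //; congr (_ * qpoch_inf _ _).
  by apply/eqP; rewrite eq_complex /=; apply/andP; split; apply/eqP; ring.
by apply/eqP; rewrite eq_complex /=; apply/andP; split; apply/eqP; ring.
Qed.

(* The factors 1 + i q^(-k) and 1 + i q^k multiply to i (q^k + q^(-k)). *)
Lemma qpoch_inf_reflect (R : realType) (q : R) (m : nat) : 0 < q -> q < 1 ->
  exists2 K : R, 0 < K &
    qpoch_inf (0 -i* q ^- m) q =
    K%:C * 'i%C ^+ m * (1 +i* 1) * qpoch_inf (0 -i* q ^+ m.+1) q.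
Proof.
move=> q0 q1; elim: m => [|m [K K0 IH]].
  exists 1 => //; rewrite expr0 invr1 expr0 expr1 rmorph1 !mul1r.
  by rewrite (@qpoch_inf_imag_funeq _ _ 1) // mul1r.
exists (K * (q ^- m.+1 + q ^+ m.+1)).
  by rewrite mulr_gt0 // addr_gt0 ?invr_gt0 ?exprn_gt0.
have u0 : q ^+ m.+1 != 0 by rewrite expf_neq0 // gt_eqF.
(* The functional equation serves twice: it splits 1 + i q^(-m-1) off the left side and 1 + i
   q^(m+1) off the tail in the induction hypothesis. *)
rewrite (@qpoch_inf_imag_funeq _ _ (q ^- m.+1)) //.
have -> : q ^- m.+1 * q = q ^- m.
  by rewrite exprS; field; rewrite expf_neq0 ?gt_eqF.
rewrite IH (@qpoch_inf_imag_funeq _ _ (q ^+ m.+1)) // -exprSr.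
have e : (1 +i* q ^- m.+1) * (1 +i* q ^+ m.+1) =
    (q ^- m.+1 + q ^+ m.+1)%:C * 'i%C.
  apply/eqP; rewrite eq_complex /=; apply/andP; split; apply/eqP; last by ring.
  by rewrite mulVf // mulr1 mulr0 mul0r !subrr.
rewrite (rmorphM (real_complex R)) /= (exprS 'i%C).
set Y := qpoch_inf _ _; set X := (_ +i* q ^- _) in e *.
set Z := (1 +i* q ^+ _) in e *; set W := 1 +i* 1.
transitivity (X * Z * (K%:C * 'i%C ^+ m * W * Y)).
  by rewrite /W; ring.
by rewrite e; set V := (_ + _)%:C; ring.
Qed.

Lemma sqr_i_exp (R : realType) (n : nat) :
  ('i%C : R[i]) ^+ (2 * n) = ((-1) ^+ n)%:C.
Proof. by rewrite exprM sqr_i rmorphXn rmorphN rmorph1. Qed.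

(** By reflection only (1 + i) P matters, with P the value at a point -i t near 0. Lipschitz
    continuity puts P = c + i s within 1/2 of 1, so the real part c - s and the imaginary part c + s
    are both positive. *)
Lemma qpoch_inf_alternate (R : realType) (q : R) : 0 < q -> q < 1 ->
  exists N, forall n, (N <= n)%N ->
    0 < (-1) ^+ n * complex.Re (qpoch_inf (0 -i* q ^- (2 * n)) q) /\
    0 < (-1) ^+ n * complex.Im (qpoch_inf (0 -i* q ^- (2 * n)) q).
Proof.
(* The Lipschitz constant of [qpoch_inf] on the unit disc; [N] is then chosen to make [t * C] less
   than 1/2. *)
move=> q0 q1; set C := (1 - q)^-1 * expR (1 / (1 - q)).
have C0 : 0 < C by rewrite mulr_gt0 ?expR_gt0 // invr_gt0 subr_gt0.
have [N hN] : exists N, forall n, (N <= n)%N -> q ^+ n < (2 * C)^-1.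
  by apply: exprn_lt_eps => //; rewrite invr_gt0 mulr_gt0.
exists N => n Nn; have [K K0 ->] := qpoch_inf_reflect (2 * n) q0 q1.
rewrite sqr_i_exp; set t := q ^+ (2 * n).+1.
have t0 : 0 < t by rewrite exprn_gt0.
have nt : normc (0 -i* t) = t.
  by rewrite /= expr0n add0r sqrtr_sqr normrN gtr0_norm.
have tC : t * C < 2^-1.
  have : t < (2 * C)^-1.
    by apply: hN; rewrite (leq_trans Nn) // mulnC muln2 -addnn -addnS leq_addr.
  by rewrite invfM ltr_pdivlMr.
have : normc (qpoch_inf (0 -i* t) q - 1) < 2^-1.
  apply: le_lt_trans tC; rewrite -[in leRHS]nt -(qpoch_inf0 q0 q1).
  rewrite -[X in normc (qpoch_inf X q - _)]add0r.
  apply: qpoch_inf_lipschitz => //; first by rewrite normc0.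
  by rewrite add0r nt exprn_ile1 // ltW.
set P := qpoch_inf _ _ => hP.
have := le_lt_trans (normr_Re_le _) hP; have := le_lt_trans (normr_Im_le _) hP.
rewrite Re_add Im_add Re_opp Im_opp !ltr_norml; case: (P) => c s /=.
rewrite oppr0 addr0 => /andP[h1 h2] /andP[h3 h4].
have sg : (-1) ^+ n * (-1) ^+ n = 1 :> R by rewrite -exprMn mulrNN mulr1 expr1n.
set g := (-1) ^+ n in sg *; split.
  rewrite (_ : g * _ = g * g * (K * (c - s))); last by ring.
  by rewrite sg mul1r mulr_gt0 //; lra.
rewrite (_ : g * _ = g * g * (K * (c + s))); last by ring.
by rewrite sg mul1r mulr_gt0 //; lra.
Qed.

Lemma increasing_index_lt (R : realType) (x : nat -> R) (m n : nat) :
  (forall m n, (1 <= m)%N -> (m < n)%N -> x m < x n) ->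
  (1 <= m)%N -> (1 <= n)%N -> x m < x n -> (m < n)%N.
Proof.
move=> mono m1 n1; apply: contraTT; rewrite -leqNgt -leNgt leq_eqVlt.
by case/orP => [/eqP ->|/mono h] //; rewrite ltW // h.
Qed.

(* Each interval between consecutive y (N + k) contains a zero, so at least k
   of the x n lie below y (N + k). *)
Lemma alternating_zeros_le (R : realType) (f : R -> R) (x y : nat -> R) (N : nat) :
  continuous f -> (forall n, 0 < y n) -> (forall n, y n < y n.+1) ->
  (forall n, (N <= n)%N -> 0 < (-1) ^+ n * f (y n)) ->
  (forall m n, (1 <= m)%N -> (m < n)%N -> x m < x n) ->
  (forall t, 0 < t -> f t = 0 -> exists2 n, (1 <= n)%N & x n = t) ->
  forall k, (1 <= k)%N -> x k <= y (N + k)%N.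
Proof.
move=> cf y0 yS alt mono zer.
have step n : (N <= n)%N -> exists m, [/\ (1 <= m)%N, y n < x m & x m < y n.+1].
  move=> Nn; have a0 := alt n Nn; have a1 := alt n.+1 (leqW Nn).
  have [t] : exists2 t, t \in `[y n, y n.+1] & f t = 0.
    apply: IVT; first exact: ltW.
      exact: continuous_subspaceT.
    (* The parity of [n] decides at which endpoint [f] is negative. *)
    move: a0 a1; rewrite exprS -signr_odd; case: odd; rewrite ?expr1 ?expr0 => a0 a1;
    rewrite ge_min le_max; apply/andP; split; apply/orP;
    by [left; lra | right; lra].
  rewrite in_itv /= => /andP[t1 t2] ft.
  have t1' : y n < t.
    by rewrite lt_neqAle t1 andbT; apply: contraTN a0 => /eqP ->; rewrite ft mulr0 ltxx.
  have t2' : t < y n.+1.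
    by rewrite lt_neqAle t2 andbT; apply: contraTN a1 => /eqP <-; rewrite ft mulr0 ltxx.
  have [m m1 xm] := zer t (lt_trans (y0 n) t1') ft.
  by exists m; rewrite xm.
(* The zero found in the next interval lies beyond [x m], so its index exceeds [m]. *)
have key k : exists m, [/\ (k < m)%N & x m < y (N + k.+1)%N].
  elim: k => [|k [m [km xm]]].
    by have [m [m1 _ h]] := step N (leqnn N); exists m; rewrite addn1.
  have [p [p1 h1 h2]] := step (N + k.+1)%N (leq_addr _ _).
  exists p; rewrite addnS; split => //.
  have mp : (m < p)%N.
    apply: (increasing_index_lt mono) => //; last exact: lt_trans xm h1.
    exact: leq_trans (ltn0Sn k) km.
  exact: leq_ltn_trans km mp.
case=> // k _; have [m [km xm]] := key k.
apply: ltW; apply: le_lt_trans xm.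
by move: km; rewrite leq_eqVlt => /orP[/eqP ->|/mono h] //; rewrite ltW // h.
Qed.

Lemma lipschitz_continuous (R : realType) (f : R -> R) :
  (forall x, exists K, forall h, `|h| <= 1 -> `|f (x + h) - f x| <= K * `|h|) ->
  continuous f.
Proof.
move=> hf x; have [K hK] := hf x; apply/cvgrPdist_le => e e0.
have K1 : 0 < `|K| + 1 by rewrite ltr_wpDl.
exists (Num.min 1 (e / (`|K| + 1))) => /=; first by rewrite lt_min ltr01 divr_gt0.
move=> z /=; rewrite lt_min distrC => /andP[h1 h2].
have := hK _ (ltW h1); rewrite (addrC x) subrK distrC => h3; apply: le_trans h3 _.
move: h2; rewrite ltr_pdivlMr // => /ltW; apply: le_trans.
by rewrite mulrC ler_wpM2l //; have := ler_norm K; lra.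
Qed.

Lemma qpoch_inf_imag_lipschitz (R : realType) (q a x : R) : 0 < q -> q < 1 ->
  exists K, forall h, `|h| <= 1 ->
  normc (qpoch_inf (0 -i* (a * (x + h))) q - qpoch_inf (0 -i* (a * x)) q) <= K * `|h|.
Proof.
move=> q0 q1; set r := `|a * x| + `|a|.
have nt (t : R) : normc (0 -i* t) = `|t|.
  by rewrite /= expr0n add0r sqrtr_sqr normrN.
exists (`|a| * ((1 - q)^-1 * expR (r / (1 - q)))) => h h1.
have -> : 0 -i* (a * (x + h)) = 0 -i* (a * x) + (0 -i* (a * h)).
  by apply/eqP; rewrite eq_complex /=; apply/andP; split; apply/eqP; ring.
rewrite mulrAC -normrM -(nt (a * h)); apply: qpoch_inf_lipschitz => //.
  by rewrite nt lerDl.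
apply: le_trans (le_normc_add _ _) _; rewrite !nt lerD2l normrM ler_piMr //.
Qed.

(* num and den stand for Cos_q and Sin_q', or for Sin_q and Cos_q', on the real
   line; the sign b is -1 in the first case and 1 in the second. *)
Lemma ratio_bound (R : realType) (q : R) (N : nat) (x : nat -> R)
    (num den : R -> R[i]) :
  0 < q -> q < 1 ->
  (forall n, (1 <= n)%N -> 0 < x n /\ x n <= q ^- (2 * (N + n)) / (1 - q)) ->
  (forall n L, (1 <= n)%N -> geom_cvg q (qlogder (0 -i* ((1 - q) * x n)) q) L ->
    exists c b : R, [/\ num (x n) = c%:C, `|b| = 1 &
                   den (x n) = (b * c * ((1 - q) * complex.Re L))%:C]) ->
  [bounded (q%:C ^+ (2 * n) * (num (x n) / den (x n)) : R[i]^o)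
    | n in [set n : nat | (1 <= n)%N]].
Proof.
(* With p = q^(2(N+n)), the denominator will satisfy |r| >= (1-q) p / 2, whence q^(2n) / |r| <=
   [B]. *)
move=> q0 q1 hx hL; set B := 2 / ((1 - q) * q ^+ (2 * N)).
have a0 : 0 < 1 - q by rewrite subr_gt0.
have B0 : 0 <= B.
  by rewrite divr_ge0 // mulr_ge0 ?exprn_ge0 ?(ltW a0) ?(ltW q0).
exists B%:C; split; first by rewrite ger0_real // lecR.
move=> M BM n /= n1; apply: le_trans (ltW BM).
have [x0 xle] := hx n n1.
have [L cL] := qlogder_cvg (x := 0 -i* ((1 - q) * x n)) q0 q1 erefl.
have [c [b [-> b1 ->]]] := hL n L n1 cL.
(* For this term the bound on [x n] gives s = (1-q) x_n p <= 1, so p / (1 + s^2) is at least p /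
   2. *)
have := Re_qlogder_le (2 * (N + n)) q0 q1 cL.
set p := q ^+ _; have p0 : 0 < p by rewrite exprn_gt0.
set s := _ * p => hRe.
have s01 : 0 <= s <= 1.
  rewrite /s !mulr_ge0 ?(ltW a0) ?(ltW x0) ?(ltW p0) //=.
  by rewrite -ler_pdivlMr // div1r mulrC -ler_pdivlMr.
have Lp : p / 2 <= - complex.Re L.
  rewrite lerNr; apply: le_trans hRe _; rewrite lerN2.
  rewrite ler_pM2l // lef_pV2 ?posrE ?ltr_pwDl ?sqr_ge0 //.
  by case/andP: s01 => ? ?; have := @exprn_ile1 _ 2 s; lra.
set r := (1 - q) * complex.Re L.
have Br : q ^+ (2 * n) <= B * `|r|.
  rewrite /r normrM gtr0_norm // ltr0_norm; last by lra.
  have -> : q ^+ (2 * n) = B * ((1 - q) * (p / 2)).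
    rewrite /B /p mulnDr exprD; field.
    by rewrite expf_neq0 ?gt_eqF.
  by rewrite ler_wpM2l // ler_pM2l.
have r0 : 0 < `|r| by rewrite normr_gt0 mulf_neq0 ?(gt_eqF a0) // lt_eqF //; lra.
rewrite norm_normc -rmorphXn -fmorphV -!rmorphM lecR normc_real.
rewrite normrM ger0_norm ?exprn_ge0 ?(ltW q0) //.
(* For [c = 0] the quotient is 0 / 0, which is 0 by convention. *)
have [-> | c0] := eqVneq c 0.
  by rewrite mul0r normr0 mulr0.
have -> : `|c / (b * c * r)| = `|r|^-1.
  rewrite normf_div (normrM (b * c)) normrM b1 mul1r invfM mulrA.
  by rewrite divff ?normr_eq0 // mul1r.
by rewrite ler_pdivrMr.
Qed.

(** Treats both functions at once, with [p] the real or the imaginary part. The Lipschitz bound on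
    [p] yields the continuity needed for the intermediate value theorem, applied between the points
    q^(-2n) / (1-q). *)
Lemma zeros_upper_bound (R : realType) (q : R) (p : R[i] -> R) (f : R[i] -> R[i])
    (x : nat -> R) :
  0 < q -> q < 1 ->
  (forall y z, `|p y - p z| <= normc (y - z)) ->
  (forall t, f t%:C = (p (qpoch_inf (0 -i* ((1 - q) * t)) q))%:C) ->
  (exists N, forall n, (N <= n)%N ->
    0 < (-1) ^+ n * p (qpoch_inf (0 -i* q ^- (2 * n)) q)) ->
  positive_zeros f x ->
  exists N, forall n, (1 <= n)%N -> 0 < x n /\ x n <= q ^- (2 * (N + n)) / (1 - q).
Proof.
move=> q0 q1 plip fE [N alt] [mono zer].
have a0 : 0 < 1 - q by rewrite subr_gt0.
exists N => n n1; split.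
  by have [|] := (zer (x n)).2 => //; exists n.
apply: (@alternating_zeros_le _ (fun t => p (qpoch_inf (0 -i* ((1 - q) * t)) q)) x
  (fun n => q ^- (2 * n) / (1 - q)) N) => //.
- apply: lipschitz_continuous => t.
  have [K hK] := qpoch_inf_imag_lipschitz (1 - q) t q0 q1.
  by exists K => h h1; apply: le_trans (plip _ _) (hK h h1).
- by move=> m; rewrite divr_gt0 // invr_gt0 exprn_gt0.
- move=> m; rewrite ltr_pM2r ?invr_gt0 // ltf_pV2 ?posrE ?exprn_gt0 //.
  by rewrite mulnS addnC exprD gtr_pMr ?exprn_gt0 // exprn_ilt1 // ltW.
- by move=> m /alt; rewrite (mulrC (1 - q)) divfK // gt_eqF.
- by move=> t t0 ft; apply/zer; rewrite fE ft.
Qed.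

Unset Implicit Arguments.
Set Strict Implicit.

Theorem lemma3p12 (R : realType) (q : R) (xi eta : nat -> R)
    (hq0 : 0 < q) (hq1 : q < 1)
    (hxi : positive_zeros (Sin_q q) xi)
    (heta : positive_zeros (Cos_q q) eta) :
  [bounded (q%:C ^+ (2 * n) * (Cos_q q (xi n)%:C / cderiv (Sin_q q) (xi n)%:C)
            : R[i]^o) | n in [set n : nat | (1 <= n)%N]] /\
  [bounded (q%:C ^+ (2 * n) * (Sin_q q (eta n)%:C / cderiv (Cos_q q) (eta n)%:C)
            : R[i]^o) | n in [set n : nat | (1 <= n)%N]].
Proof.
have [M alt] := qpoch_inf_alternate hq0 hq1; split.
- have [N hN] : exists N, forall n, (1 <= n)%N ->
      0 < xi n /\ xi n <= q ^- (2 * (N + n)) / (1 - q).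
    apply: (zeros_upper_bound (p := @complex.Im R) hq0 hq1 _ _ _ hxi) => [y z|t|].
    + by rewrite -Im_opp -Im_add; exact: normr_Im_le.
    + exact: Sin_q_real.
    + by exists M => n /alt [].
  apply: (@ratio_bound R q N xi (fun x => Cos_q q x%:C)
    (fun x => cderiv (Sin_q q) x%:C)) => // n L n1 cL.
  have [_ S0] := (hxi.2 (xi n)).2 (ex_intro2 _ _ n n1 erefl).
  move: S0; rewrite Sin_q_real // => /complexI.
  rewrite Cos_q_real // (cderiv_Sin_q hq0 hq1 cL).
  (* At a zero of [Sin_q] the product is the real number c, so Re (c L) = c Re L; the sign is that
     of [cderiv_Sin_q]. *)
  case: (qpoch_inf _ q) (L) => [c s] [l m] /= ->.
  exists c, (-1); split => //; first by rewrite normrN1.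
  by congr (_%:C); ring.
- have [N hN] : exists N, forall n, (1 <= n)%N ->
      0 < eta n /\ eta n <= q ^- (2 * (N + n)) / (1 - q).
    apply: (zeros_upper_bound (p := @complex.Re R) hq0 hq1 _ _ _ heta) => [y z|t|].
    + by rewrite -Re_opp -Re_add; exact: normr_Re_le.
    + exact: Cos_q_real.
    + by exists M => n /alt [].
  apply: (@ratio_bound R q N eta (fun x => Sin_q q x%:C)
    (fun x => cderiv (Cos_q q) x%:C)) => // n L n1 cL.
  have [_ S0] := (heta.2 (eta n)).2 (ex_intro2 _ _ n n1 erefl).
  move: S0; rewrite Cos_q_real // => /complexI.
  rewrite Sin_q_real // (cderiv_Cos_q hq0 hq1 cL).
  (* At a zero of [Cos_q] the product is i s, and Im (i s L) = s Re L. *)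
  case: (qpoch_inf _ q) (L) => [c s] [l m] /= ->.
  exists s, 1; split => //; first by rewrite normr1.
  by congr (_%:C); ring.
Qed.
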